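(* Let $p,q$ be distinct primes, $n$ a positive integer with $pq\mid n$, and $G=\mathbb{Z}_{pq}\times\mathbb{Z}_n$. Let $d_1,\dots,d_k$ be all the divisors of $n$, ordered in consecutive groups as follows: the first $r_1$ are relatively prime to $pq$; the next $r_2$ are divisible by $p$ but by neither $p^2$ nor $q$; the next $r_3$ are divisible by $p^2$ but not by $q$; the next $r_4$ are divisible by $q$ but by neither $q^2$ nor $p$; the next $r_5$ are divisible by $q^2$ but not by $p$; the next $r_6$ are divisible by $pq$ but by neither $p^2q$ nor $pq^2$; the next $r_7$ are divisible by $p^2q$ but not by $pq^2$; the next $r_8$ are divisible by $pq^2$ but not by $p^2q$; and the remaining ones are multiples of $p^2q^2$ ($r_3,r_5,r_7,r_8$ and the number of remaining ones may be $0$). Put $t_i=\sum_{j=1}^{i}r_j$ for $1\le i\le 8$. Let $S_1,\dots,S_l$, with $$l=r_1+(p+1)r_2+pr_3+(q+1)r_4+qr_5+(pq+p+q+1)r_6+(pq+p)r_7+(pq+q)r_8+pq\Big(k-\sum_{j=1}^{8}r_j\Big),$$ be the list of all cyclic subgroups of $G$. Then $$\psi(A(\mathscr{P}(G)),x)=(1+x)^{\alpha}\,\psi(Q,x),$$ where $$\begin{aligned}\alpha={}&\sum_{i=1}^{t_1}(\phi(d_i)-1)+(p+1)\sum_{i=t_1+1}^{t_2}(\phi(d_i)-1)+p\sum_{i=t_2+1}^{t_3}(\phi(d_i)-1)+(q+1)\sum_{i=t_3+1}^{t_4}(\phi(d_i)-1)\\&+q\sum_{i=t_4+1}^{t_5}(\phi(d_i)-1)+(pq+p+q+1)\sum_{i=t_5+1}^{t_6}(\phi(d_i)-1)+(pq+p)\sum_{i=t_6+1}^{t_7}(\phi(d_i)-1)\\&+(pq+q)\sum_{i=t_7+1}^{t_8}(\phi(d_i)-1)+pq\sum_{i=t_8+1}^{k}(\phi(d_i)-1)\end{aligned}$$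 and $Q=(q_{ij})_{l\times l}$ with $$q_{ij}=\begin{cases}\phi(|S_j|)&\text{if } i\neq j\text{ and }T_{S_i}\sim T_{S_j},\\ \phi(|S_i|)-1&\text{if } i=j,\\ 0&\text{otherwise.}\end{cases}$$
   Context: For a finite group $G$, the power graph $\mathscr{P}(G)$ is the simple graph with vertex set $G$ in which two distinct vertices $x,y$ are adjacent iff $x=y^k$ or $y=x^k$ for some $k\in\mathbb{N}$. $A(H)$ is the adjacency matrix of a graph $H$; for a square matrix $N$, $\psi(N,x)=\det(xI-N)$. $\phi$ is Euler's totient function. For a cyclic subgroup $C$, $T_C$ denotes the set of all generators of $C$. For disjoint vertex sets $X,Y$, $X\sim Y$ means every vertex of $X$ is adjacent to every vertex of $Y$ (in $\mathscr{P}(G)$). The list $S_1,\dots,S_l$ contains each cyclic subgroup of $G$ exactly once; its order is immaterial, since reordering conjugates $Q$ by a permutation matrix. *)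

(* Defs.v *)
From HB Require Import structures.
From mathcomp Require Import all_boot all_order all_algebra.
From mathcomp Require Import all_fingroup all_solvable.
From mathcomp Require Import boolp.

Set Implicit Arguments.
Unset Strict Implicit.
Unset Printing Implicit Defensive.

Import GRing.Theory.
Local Open Scope ring_scope.

(* Allowing the exponent 0 is harmless: in a finite group 1 = y ^+ #[y]. *)
Definition is_power (gT : finGroupType) (x y : gT) : Prop :=
  exists k : nat, x = (y ^+ k)%g.

Definition power_graph (gT : finGroupType) : rel gT :=
  fun x y => `[< x <> y /\ (is_power x y \/ is_power y x) >].
Arguments power_graph : clear implicits.

Definition adjacency_mx (V : finType) (e : rel V) : 'M[int]_#|V| :=
  \matrix_(i, j) (e (enum_val i) (enum_val j))%:R.

Definition gens (gT : finGroupType) (C : {set gT}) : {set gT} :=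
  [set x | generator C x].

Definition fully_adjacent (V : finType) (e : rel V) (X Y : {set V}) : bool :=
  [forall x in X, forall y in Y, e x y].

Definition Qmx (gT : finGroupType) (l : nat) (S : l.-tuple {group gT}) :
    'M[int]_l :=
  \matrix_(i, j)
    if (i != j) &&
       fully_adjacent (power_graph gT) (gens (tnth S i)) (gens (tnth S j))
    then (totient #|tnth S j|)%:R
    else if i == j then (totient #|tnth S i|)%:R - 1
    else 0.

Definition partial_sum (r : nat -> nat) (i : nat) : nat :=
  (\sum_(1 <= j < i.+1) r j)%N.

(* The list d is indexed from 0 here, so its i-th group occupies the indices  *)
(* t (i - 1) <= j < t i.                                                      *)
Definition divisors_grouped (p q n : nat) (d : seq nat) (r : nat -> nat) :
    Prop :=
  let t := partial_sum r in
  let on_range a b (P : pred nat) :=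
    forall i, (a <= i < b)%N -> P (nth 0%N d i) in
  ([/\ perm_eq d (divisors n) & (t 8 <= size d)] /\
  [/\ on_range 0 (t 1) (fun m => coprime m (p * q)),
      on_range (t 1) (t 2)
        (fun m => [&& p %| m, ~~ (p ^ 2 %| m) & ~~ (q %| m)]),
      on_range (t 2) (t 3) (fun m => (p ^ 2 %| m) && ~~ (q %| m)),
      on_range (t 3) (t 4)
        (fun m => [&& q %| m, ~~ (q ^ 2 %| m) & ~~ (p %| m)]) &
      on_range (t 4) (t 5) (fun m => (q ^ 2 %| m) && ~~ (p %| m))] /\
  [/\ on_range (t 5) (t 6)
        (fun m => [&& p * q %| m, ~~ (p ^ 2 * q %| m) &
                      ~~ (p * q ^ 2 %| m)]),
      on_range (t 6) (t 7)
        (fun m => (p ^ 2 * q %| m) && ~~ (p * q ^ 2 %| m)),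
      on_range (t 7) (t 8)
        (fun m => (p * q ^ 2 %| m) && ~~ (p ^ 2 * q %| m)) &
      on_range (t 8) (size d) (fun m => p ^ 2 * q ^ 2 %| m)])%N.

(* Main.v *)
Require Import Defs.
From mathcomp Require Import all_boot all_order all_algebra.
From mathcomp Require Import all_fingroup all_solvable.
From mathcomp Require Import boolp zify.

(* Two vertices x, y satisfy "equal or adjacent" iff <[x]> and <[y]> are      *)
(* comparable, so A + I = P B P^T, where P is the incidence matrix between    *)
(* elements and the cyclic subgroups they generate and B is the comparability *)
(* matrix of the cyclic subgroups. As P^T P is the diagonal matrix of the     *)
(* phi(|S_j|), one also has Q + I = B P^T P. Sylvester's identity for         *)
(* det(a I - U W) then gives                                                  *)
(*   (1 + x)^l psi(A, x) = (1 + x)^|G| psi(Q, x).                             *)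
(* It remains to count. G has gcd(e, pq) e elements of order dividing e when  *)
(* e | n, and summation over divisors shows that it has c(e) phi(e) elements  *)
(* of order e, hence c(e) cyclic subgroups of order e, where                  *)
(* c(e) = c_p(e) c_q(e) and c_p(e) is 1, p + 1 or p according to whether the  *)
(* exponent of p in e is 0, 1 or at least 2.                                  *)

Set Implicit Arguments.
Unset Strict Implicit.
Unset Printing Implicit Defensive.

Import GRing.Theory.
Local Open Scope ring_scope.

(** The algebra and the counting meet in the exponent: by [sum_over_generators], |G| is the sum of
    the phi(|S_j|), so |G| - l is the sum of the phi(|S_j|) - 1, which [sum_cyclic_subgroups] and
    [sum_divisors_grouped] turn into alpha. Cancelling (1 + x)^l in [char_poly_power_graph] leaves
    the claim. *)

(** * Determinant identities *)

Lemma det_scalar_sub_mulmxC (R : comNzRingType) (m l : nat) (a : R)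
    (U : 'M[R]_(m, l)) (W : 'M[R]_(l, m)) :
  a ^+ l * \det (a%:M - U *m W) = a ^+ m * \det (a%:M - W *m U).
Proof.
(* Two block eliminations of the same matrix: clearing [W] on the right leaves a I - U W, clearing
   it on the left leaves a I - W U. *)
pose M := block_mx a%:M U W 1%:M.
have detM : \det M = \det (a%:M - U *m W).
  have : \det (M *m block_mx 1%:M 0 (- W) 1%:M) = \det (a%:M - U *m W).
    rewrite mulmx_block !mulmx1 !mulmx0 mul1mx add0r mulmxN subrr.
    by rewrite add0r det_ublock det1 mulr1.
  by rewrite det_mulmx det_lblock !det1 !mulr1.
have : \det (block_mx 1%:M 0 (- W) a%:M *m M) = a ^+ m * \det (a%:M - W *m U).
  rewrite mulmx_block !mul1mx !mul0mx !addr0 mulNmx mulmx1.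
  rewrite mul_mx_scalar mul_scalar_mx addNr mulNmx addrC.
  by rewrite det_ublock det_scalar addrC.
by rewrite det_mulmx det_lblock det1 det_scalar mul1r detM.
Qed.

Lemma char_poly_shift (R : comNzRingType) (m : nat) (A : 'M[R]_m) :
  char_poly A = \det ((1 + 'X)%:M - map_mx polyC (A + 1%:M)).
Proof.
rewrite /char_poly /char_poly_mx; congr (\det _).
apply/matrixP=> i j; rewrite !mxE polyCD.
case: (i == j); rewrite ?mulr0n ?mulr1n ?polyC0 ?polyC1 ?addr0 //.
by rewrite [1 + _]addrC opprD addrA addrAC addrK.
Qed.

(** * Factoring A + I and Q + I through the cyclic subgroups *)

Section PowerGraph.

Variables (gT : finGroupType) (l : nat) (S : l.-tuple {group gT}).
Hypothesis (S_uniq : uniq S).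
Hypothesis (S_cyclic : forall H : {group gT}, (H \in S) = cyclic H).

Definition cycle_incidence : 'M[int]_(#|gT|, l) :=
  \matrix_(i, j) (tnth S j == <[enum_val i]>%G)%:R.

Definition comparability_mx : 'M[int]_l :=
  \matrix_(i, j) ((tnth S i \subset tnth S j) || (tnth S j \subset tnth S i))%:R.

Lemma is_powerE (x y : gT) : is_power x y <-> (x \in <[y]>)%g.
Proof. by split=> [[k ->]|/cycleP[k ->]]; [exact: mem_cycle | exists k]. Qed.

Lemma power_graphE (x y : gT) :
  power_graph gT x y = (x != y) && ((x \in <[y]>%g) || (y \in <[x]>%g)).
Proof.
apply/asboolP/andP => [[/eqP xy h]|[/eqP xy /orP h]].
  by split=> //; apply/orP; case: h => /is_powerE; [left|right].
by split=> //; case: h => /is_powerE; [left|right].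
Qed.

Lemma tnth_cycle (x : gT) : exists j : 'I_l, tnth S j = <[x]>%G.
Proof.
have /tnthP[j ->] : <[x]>%G \in S by rewrite S_cyclic cycle_cyclic.
by exists j.
Qed.

Lemma tnth_generator (j : 'I_l) : exists x : gT, tnth S j = <[x]>%G.
Proof.
have : cyclic (tnth S j) by rewrite -S_cyclic mem_tnth.
by case/cyclicP=> x hx; exists x; apply/val_inj.
Qed.

Lemma tnth_S_inj : injective (tnth S).
Proof. by apply/tuple_uniqP. Qed.

(** Each row of the incidence matrix has a single 1, since <[x]> occurs exactly once in [S]. *)
Lemma sum_cycle_incidence (x : gT) (F : {group gT} -> int) :
  \sum_(j < l) (tnth S j == <[x]>%G)%:R * F (tnth S j) = F <[x]>%G.
Proof.
have [j0 hj0] := tnth_cycle x.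
rewrite (bigD1 j0) //= hj0 eqxx mul1r big1 ?addr0 // => j jj0.
by rewrite -hj0 (inj_eq tnth_S_inj) (negPf jj0) mul0r.
Qed.

Lemma adjacency_mx_factor :
  adjacency_mx (power_graph gT) + 1%:M
  = cycle_incidence *m (comparability_mx *m cycle_incidence^T).
Proof.
apply/matrixP=> a b; rewrite !mxE power_graphE.
set x := enum_val a; set y := enum_val b.
have -> : a == b = (x == y) by rewrite (inj_eq enum_val_inj).
pose F (H : {group gT}) : int :=
  ((H \subset <[y]>%g) || (<[y]>%g \subset H))%:R.
transitivity (F <[x]>%G).
  rewrite /F /= !cycle_subG; have [->|_] := eqVneq x y.
    by rewrite cycle_id.
  by rewrite addr0.
rewrite -sum_cycle_incidence; apply: eq_bigr => i _; rewrite !mxE; congr (_ * _).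
pose F' (H : {group gT}) : int :=
  ((tnth S i \subset H) || (H \subset tnth S i))%:R.
rewrite -[LHS]/(F' <[y]>%G) -sum_cycle_incidence; apply: eq_bigr => j _.
by rewrite !mxE mulrC.
Qed.

(** Adjacency of distinct elements depends only on the subgroups they generate. Generators of
    different subgroups are distinct, and generators exist, so full adjacency is never vacuous. *)
Lemma fully_adjacent_gens (i j : 'I_l) : i != j ->
  fully_adjacent (power_graph gT) (gens (tnth S i)) (gens (tnth S j))
  = (tnth S i \subset tnth S j) || (tnth S j \subset tnth S i).
Proof.
move=> ij; have nS : tnth S i != tnth S j by rewrite (inj_eq tnth_S_inj).
apply/forall_inP/idP=> [h|h x].
  have [x hx] := tnth_generator i; have [y hy] := tnth_generator j.
  have /h/forall_inP/(_ y) : x \in gens (tnth S i).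
    by rewrite inE hx generator_cycle.
  rewrite inE hy generator_cycle power_graphE => /(_ isT)/andP[_].
  by rewrite hx /= !cycle_subG.
rewrite inE => /eqP hx; apply/forall_inP=> y; rewrite inE => /eqP hy.
rewrite power_graphE -!cycle_subG /= -hx -hy h andbT.
apply: contra nS => /eqP xy; apply/eqP/val_inj.
by rewrite /= hx hy xy.
Qed.

Lemma card_gens (C : {group gT}) : cyclic C -> #|gens C| = totient #|C|.
Proof.
case/cyclicP=> x ->; rewrite -orderE totient_gen.
by apply: eq_card => y; rewrite !inE.
Qed.

Lemma Qmx_factor :
  Qmx S + 1%:M = (comparability_mx *m cycle_incidence^T) *m cycle_incidence.
Proof.
rewrite -mulmxA; apply/matrixP=> i j; rewrite !mxE.
(* No element generates two different subgroups, so the product is diagonal, and its entries count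
   generators. *)
have D a : (cycle_incidence^T *m cycle_incidence) a j
    = if a == j then (totient #|tnth S j|)%:R else 0.
  rewrite mxE; case: eqVneq => [->|aj]; last first.
    apply: big1 => c _; rewrite !mxE.
    case: eqP => [<-|]; last by rewrite mul0r.
    by rewrite (inj_eq tnth_S_inj) eq_sym (negPf aj) mulr0.
  rewrite -card_gens -?S_cyclic ?mem_tnth // -sum1_card natr_sum [RHS]big_mkcond /=.
  rewrite [RHS](reindex_omap (fun c : 'I_#|gT| => enum_val c)
     (fun x => Some (enum_rank x))) /=; last first.
    by move=> x _; rewrite enum_rankK.
  apply: eq_big => c; first by rewrite /= enum_valK eqxx.
  move=> _; rewrite !mxE inE /generator -val_eqE /=.
  by case: eqP; rewrite ?mul0r ?mulr1.
rewrite (bigD1 j) //= D eqxx big1 => [|a aj]; last by rewrite D (negPf aj) mulr0.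
rewrite addr0 mxE; case: eqVneq => [->|ij] /=.
  by rewrite subxx mul1r subrK.
rewrite fully_adjacent_gens // addr0; case: ifP; rewrite ?mul1r ?mul0r //.
Qed.

(** Sylvester's identity over Z[x] with a = 1 + x, U = P and W = B P^T. *)
Lemma char_poly_power_graph :
  (1 + 'X) ^+ l * char_poly (adjacency_mx (power_graph gT))
  = (1 + 'X) ^+ #|gT| * char_poly (Qmx S).
Proof.
rewrite !char_poly_shift adjacency_mx_factor Qmx_factor !map_mxM.
exact: det_scalar_sub_mulmxC.
Qed.

(** * Counting elements by the subgroup they generate *)

Local Open Scope nat_scope.

Lemma sum_over_generators (F : {group gT} -> nat) :
  \sum_x F <[x]>%G = \sum_(j < l) totient #|tnth S j| * F (tnth S j).
Proof.
transitivity (\sum_x \sum_(j < l | tnth S j == <[x]>%G) F (tnth S j)).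
  apply: eq_bigr => x _; have [j0 hj0] := tnth_cycle x.
  rewrite (big_pred1 j0) ?hj0 // => j.
  by rewrite -hj0 (inj_eq tnth_S_inj).
rewrite (exchange_big_dep xpredT) //=; apply: eq_bigr => j _.
rewrite -card_gens -?S_cyclic ?mem_tnth // -sum_nat_const; apply: eq_bigl => x.
by rewrite inE /generator -val_eqE.
Qed.

Lemma card_order_eq_sum (e : nat) :
  #|[set x : gT | #[x]%g == e]|
  = \sum_(j < l) (#|tnth S j| == e) * totient e.
Proof.
rewrite -sum1_card big_mkcond /=.
transitivity (\sum_(x : gT) (#|<[x]>%G| == e)).
  by apply: eq_bigr => x _; rewrite inE; case: (_ == e).
rewrite (sum_over_generators (fun H => nat_of_bool (#|H| == e))).
apply: eq_bigr => j _.
by rewrite mulnC; case: eqP => [->|].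
Qed.

End PowerGraph.

(** * Weighted divisor sums *)

Section Arithmetic.
Local Open Scope nat_scope.

(** The local factor c_p: if p^a exactly divides m, this is the number of cyclic subgroups of order
    p^a in Z_p x Z_(p^b), for any b >= 1 with b >= a. *)
Definition prime_weight (p m : nat) : nat :=
  if p ^ 2 %| m then p else if p %| m then p.+1 else 1.

Lemma sum_divisors_mul (F : nat -> nat) (p d : nat) :
  prime p -> 0 < d -> p %| d ->
  \sum_(e <- divisors d | (p %| e) && ~~ (p ^ 2 %| e)) F e
  = \sum_(e <- divisors d | ~~ (p %| e)) F (p * e).
Proof.
move=> p_pr d_gt0 pd; have p_gt0 := prime_gt0 p_pr.
rewrite -[RHS]big_filter -[LHS]big_filter -[RHS](big_map (muln p) xpredT).
apply/perm_big/uniq_perm; first exact/filter_uniq/divisors_uniq.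
  rewrite map_inj_uniq ?filter_uniq ?divisors_uniq //.
  by move=> a b /eqP; rewrite eqn_pmul2l // => /eqP.
move=> e; rewrite mem_filter -dvdn_divisors //.
apply/andP/mapP=> [[/andP[/dvdnP[f ->] hf] hd]|[f]].
  exists f; last by rewrite mulnC.
  rewrite expnS expn1 dvdn_pmul2r // in hf.
  by rewrite mem_filter hf -dvdn_divisors // (dvdn_trans _ hd) ?dvdn_mulr.
rewrite mem_filter -dvdn_divisors // => /andP[hf fd] ->.
rewrite dvdn_mulr // expnS expn1 dvdn_pmul2l // hf Gauss_dvd ?pd ?fd //.
by rewrite prime_coprime.
Qed.

(** [F] is kept general so that it can absorb the weight of a second prime; only its behaviour under
    e |-> p * e matters. *)
Lemma sum_prime_weight (F : nat -> nat) (p d : nat) :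
  prime p -> 0 < d ->
  (forall e, e %| d -> ~~ (p %| e) -> F (p * e) = p.-1 * F e) ->
  \sum_(e <- divisors d) prime_weight p e * F e
  = gcdn p d * \sum_(e <- divisors d) F e.
Proof.
move=> p_pr d_gt0 hF; have p_gt0 := prime_gt0 p_pr.
have div_d e : e \in divisors d -> e %| d by rewrite dvdn_divisors.
have [pd|pd] := boolP (p %| d); last first.
  have /eqP-> : coprime p d by rewrite prime_coprime.
  rewrite mul1n big_seq [RHS]big_seq; apply: eq_bigr => e /div_d ed.
  rewrite /prime_weight !ifN ?mul1n //; first by apply: contra pd => /dvdn_trans->.
  by apply: contra pd => h; apply: dvdn_trans ed; apply: dvdn_trans h; rewrite dvdn_exp.
rewrite (gcdn_idPl pd).
(* The weight of e is p - (p - 1) [p does not divide e] + [p || e], and e |-> *)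
(* p * e maps the divisors prime to p onto those with p || e.                 *)
pose s1 := \sum_(e <- divisors d | ~~ (p %| e)) F e.
pose s2 := \sum_(e <- divisors d | (p %| e) && ~~ (p ^ 2 %| e)) F e.
have e2 : s2 = p.-1 * s1.
  rewrite /s2 sum_divisors_mul // big_distrr big_seq_cond [RHS]big_seq_cond.
  by apply: eq_bigr => e /andP[/div_d ed pe]; apply: hF.
(* The negative correction is moved to the left, avoiding truncated subtraction; by [e2] the two
   corrections cancel. *)
have : \sum_(e <- divisors d) prime_weight p e * F e + p.-1 * s1
   = p * \sum_(e <- divisors d) F e + s2.
  rewrite /s1 /s2 !big_distrr /= (big_mkcond (fun e => ~~ _)).
  rewrite [X in _ = _ + X]big_mkcond -!big_split /=; apply: eq_bigr => e _.
  rewrite /prime_weight; have [h|_] := boolP (p ^ 2 %| e).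
    by rewrite (dvdn_trans _ h) ?dvdn_exp // andbF.
  by case: (p %| e) => /=; nia.
lia.
Qed.

Lemma totient_mul_prime (p e : nat) :
  prime p -> ~~ (p %| e) -> totient (p * e) = p.-1 * totient e.
Proof.
by move=> p_pr pe; rewrite totient_coprime ?prime_coprime // totient_prime.
Qed.

Lemma prime_weight_mul (p q e : nat) :
  prime p -> prime q -> p != q -> prime_weight q (p * e) = prime_weight q e.
Proof.
move=> p_pr q_pr pq; rewrite /prime_weight.
have cop : coprime q p by rewrite prime_coprime // dvdn_prime2 // eq_sym.
by rewrite !Gauss_dvdr ?coprimeXl.
Qed.

Lemma sum_divisors_totient (d : nat) :
  0 < d -> \sum_(e <- divisors d) totient e = d.
Proof.
move=> d_gt0; rewrite -[RHS]sum_totient_dvd -(big_mkord (dvdn^~ d)).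
rewrite -[RHS]big_filter; apply/perm_big/uniq_perm; rewrite ?divisors_uniq //.
  by rewrite filter_uniq ?iota_uniq.
move=> e; rewrite mem_filter -dvdn_divisors // mem_index_iota leq0n ltnS /=.
by apply/idP/andP=> [h|[]//]; split=> //; apply: dvdn_leq.
Qed.

(** Removing the weights one prime at a time yields gcd(p, d) gcd(q, d) d, and the gcds multiply
    because p and q are coprime. *)
Lemma sum_prime_weights_totient (p q d : nat) :
  prime p -> prime q -> p != q -> 0 < d ->
  \sum_(e <- divisors d) prime_weight p e * (prime_weight q e * totient e)
  = gcdn d (p * q) * d.
Proof.
move=> p_pr q_pr pq d_gt0; rewrite sum_prime_weight //; last first.
  by move=> e _ pe; rewrite prime_weight_mul // totient_mul_prime // mulnCA.
rewrite sum_prime_weight // => [|e _ qe]; last exact: totient_mul_prime.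
rewrite sum_divisors_totient // mulnA; congr (_ * d).
have pq' : coprime p q by rewrite prime_coprime // dvdn_prime2.
rewrite !(gcdnC _ d); have [pd|pd] := boolP (p %| d); last first.
  have dp : coprime d p by rewrite coprime_sym prime_coprime.
  by rewrite Gauss_gcdr // (eqP dp) mul1n.
have [qd|qd] := boolP (q %| d).
  by rewrite !(gcdn_idPr _) // Gauss_dvd // pd.
have dq : coprime d q by rewrite coprime_sym prime_coprime.
by rewrite Gauss_gcdl // (eqP dq) muln1.
Qed.

(** The boolean [==>] lets case analysis on the divisibility tests discard impossible
    combinations. *)
Lemma sqr_dvd (a m : nat) : (a ^ 2 %| m) ==> (a %| m).
Proof. by apply/implyP; apply: dvdn_trans; rewrite expnS dvdn_mulr. Qed.

Ltac prime_weight_cases p q m :=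
  rewrite /prime_weight;
  have := sqr_dvd p m; have := sqr_dvd q m;
  do 4![case: (_ %| _)] => //= *; lia.

(** The product of the two weights is constant on each group of divisors; the groups are split off
    from the last to the first. *)
Lemma sum_divisors_grouped (p q n k : nat) (d : k.-tuple nat)
    (r : nat -> nat) (g : nat -> nat) :
  prime p -> prime q -> p <> q -> divisors_grouped p q n d r ->
  let t := partial_sum r in
  let sum_g a b := \sum_(a <= i < b) g (nth 0 d i) in
  \sum_(e <- divisors n) prime_weight p e * prime_weight q e * g e =
    sum_g 0 (t 1)
     + (p + 1) * sum_g (t 1) (t 2)
     + p * sum_g (t 2) (t 3)
     + (q + 1) * sum_g (t 3) (t 4)
     + q * sum_g (t 4) (t 5)
     + (p * q + p + q + 1) * sum_g (t 5) (t 6)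
     + (p * q + p) * sum_g (t 6) (t 7)
     + (p * q + q) * sum_g (t 7) (t 8)
     + p * q * sum_g (t 8) k.
Proof.
move=> p_pr q_pr p_neq_q [[perm_d t8k] [[h1 h2 h3 h4 h5] [h6 h7 h8 h9]]] t sum_g.
rewrite size_tuple in t8k h9.
have tS i : t i <= t i.+1 by rewrite /t /partial_sum [leqRHS]big_nat_recr //= leq_addr.
rewrite -(perm_big _ perm_d) (big_nth 0) size_tuple /=.
have pq : coprime p q by rewrite prime_coprime // dvdn_prime2 //; apply/eqP.
pose w m := prime_weight p m * prime_weight q m.
have range c a b : (forall i, a <= i < b -> w (nth 0 d i) = c) ->
    \sum_(a <= i < b) w (nth 0 d i) * g (nth 0 d i) = c * sum_g a b.
  by move=> h; rewrite big_distrr /=; apply: eq_big_nat => i /h->.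
have GE m : [/\ (p * q %| m) = (p %| m) && (q %| m),
    (p ^ 2 * q %| m) = (p ^ 2 %| m) && (q %| m),
    (p * q ^ 2 %| m) = (p %| m) && (q ^ 2 %| m) &
    (p ^ 2 * q ^ 2 %| m) = (p ^ 2 %| m) && (q ^ 2 %| m)].
  by split; rewrite Gauss_dvd ?coprimeXl ?coprimeXr.
rewrite (@big_cat_nat _ _ _ (t 8)) //= (range (p * q) (t 8)); last first.
  move=> i /h9; case: (GE (nth 0 d i)) => _ _ _ ->; rewrite /w /prime_weight.
  by case/andP=> -> ->.
rewrite (@big_cat_nat _ _ _ (t 7)) //= (range (p * q + q) (t 7)); last first.
  move=> i /h8; case: (GE (nth 0 d i)) => _ -> -> _; rewrite /w.
  prime_weight_cases p q (nth 0 d i).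
rewrite (@big_cat_nat _ _ _ (t 6)) //= (range (p * q + p) (t 6)); last first.
  move=> i /h7; case: (GE (nth 0 d i)) => _ -> -> _; rewrite /w.
  prime_weight_cases p q (nth 0 d i).
rewrite (@big_cat_nat _ _ _ (t 5)) //= (range (p * q + p + q + 1) (t 5)); last first.
  move=> i /h6; case: (GE (nth 0 d i)) => -> -> -> _; rewrite /w.
  prime_weight_cases p q (nth 0 d i).
rewrite (@big_cat_nat _ _ _ (t 4)) //= (range q (t 4)); last first.
  move=> i /h5; rewrite /w.
  prime_weight_cases p q (nth 0 d i).
rewrite (@big_cat_nat _ _ _ (t 3)) //= (range (q + 1) (t 3)); last first.
  move=> i /h4; rewrite /w.
  prime_weight_cases p q (nth 0 d i).
rewrite (@big_cat_nat _ _ _ (t 2)) //= (range p (t 2)); last first.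
  move=> i /h3; rewrite /w.
  prime_weight_cases p q (nth 0 d i).
rewrite (@big_cat_nat _ _ _ (t 1)) //= (range (p + 1) (t 1)); last first.
  move=> i /h2; rewrite /w.
  prime_weight_cases p q (nth 0 d i).
rewrite (range 1 0) ?mul1n // => i /h1.
rewrite coprimeMr ![coprime (nth 0 d i) _]coprime_sym !prime_coprime //.
rewrite /w.
prime_weight_cases p q (nth 0 d i).
Qed.

End Arithmetic.

(** * Elements of order dividing m in cyclic groups and products *)

Section CyclicCounts.
Local Open Scope nat_scope.
Local Open Scope group_scope.

(** These elements form the subgroup of order gcd(m, |G|): in a cyclic group, inclusion of subgroups
    is divisibility of their orders. *)
Lemma card_order_dvd_cyclic (gT : finGroupType) (G : {group gT}) (m : nat) :
  cyclic G -> #|[set x in G | #[x] %| m]| = gcdn m #|G|.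
Proof.
move=> cycG; case/cyclicP: (cycG) => x defG.
have gx : gcdn m #|G| %| #[x] by rewrite orderE -defG dvdn_gcdr.
have /setP/(_ <[x ^+ (#[x] %/ gcdn m #|G|)]>%G) := cycle_sub_group gx.
set H := <[_]>%G; rewrite !inE eqxx -defG => /andP[sH /eqP cH].
rewrite -[RHS]cH; apply: eq_card => y; rewrite inE.
have [yG|yG] := boolP (y \in G); last first.
  by apply/esym/negbTE; apply: contra yG; apply: subsetP.
rewrite -(cycle_subG y H) -(cardSg_cyclic cycG (H := <[y]>)) ?cycle_subG //.
by rewrite (cH : #|H| = _) dvdn_gcd -orderE order_dvdG // andbT.
by rewrite -cycle_subG.
Qed.

Lemma cyclic_Zp_setT (m : nat) : cyclic [set: 'Z_m].
Proof. by apply/cyclicP; exists Zp1; apply: Zp_cycle. Qed.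

Lemma card_order_dvd_prod (aT bT : finGroupType) (m : nat) :
  #|[set x : aT * bT | #[x] %| m]|
  = (#|[set a : aT | #[a] %| m]| * #|[set b : bT | #[b] %| m]|)%N.
Proof.
rewrite -cardsX; apply: eq_card => -[a b]; rewrite !inE !order_dvdn.
have -> : (a, b) ^+ m = (a ^+ m, b ^+ m); last by [].
by elim: m => [|m IH]; rewrite ?expg0 // !expgS IH.
Qed.

End CyclicCounts.

(** * Elements and cyclic subgroups of each order in G *)

Section OrderCounts.
Local Open Scope nat_scope.

Lemma card_order_dvd_ZmxZn (m n d : nat) : 1 < m -> 1 < n ->
  d %| n -> #|[set x : 'Z_m * 'Z_n | #[x]%g %| d]| = gcdn d m * d.
Proof.
move=> m1 n1 dn; rewrite card_order_dvd_prod.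
have cZ k : 1 < k -> #|[set x : 'Z_k | #[x]%g %| d]| = gcdn d k.
  (* The bound matters: ['Z_k] has two elements when k <= 1. *)
  move=> k1; have cardZ : #|[set: 'Z_k]| = k by rewrite cardsT card_ord Zp_cast.
  have := card_order_dvd_cyclic d (cyclic_Zp_setT k).
  by rewrite cardZ => <-; apply: eq_card => x; rewrite !inE.
by rewrite !cZ // (gcdn_idPl dn).
Qed.

Lemma card_order_dvd (gT : finGroupType) (d : nat) : 0 < d ->
  #|[set x : gT | #[x]%g %| d]|
  = \sum_(e <- divisors d) #|[set x : gT | #[x]%g == e]|.
Proof.
move=> d_gt0.
have cardE (P : pred gT) : #|[set x | P x]| = \sum_x P x.
  by rewrite -sum1_card big_mkcond; apply: eq_bigr => x _; rewrite inE; case: (P x).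
under [RHS]eq_bigr do rewrite cardE; rewrite exchange_big cardE /=.
apply: eq_bigr => x _; rewrite dvdn_divisors // -count_uniq_mem ?divisors_uniq //.
rewrite -sum1_count big_mkcond; apply: eq_bigr => e _.
by rewrite /= eq_sym; case: (_ == _).
Qed.

(** Uniqueness in Moebius inversion: by strong induction the terms at proper divisors agree and
    cancel. *)
Lemma eq_sum_divisors (F F' : nat -> nat) (n : nat) : 0 < n ->
  (forall d, d %| n -> \sum_(e <- divisors d) F e = \sum_(e <- divisors d) F' e) ->
  forall d, d %| n -> F d = F' d.
Proof.
move=> n_gt0 h; elim/ltn_ind => d IH dn; have d_gt0 := dvdn_gt0 n_gt0 dn.
have := h d dn; rewrite !(bigD1_seq d) ?divisors_uniq ?divisors_id //=.
rewrite ![\sum_(i <- _ | i != d) _]big_seq_cond.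
rewrite (eq_bigr F') => [/addIn//|e /andP[]].
rewrite -dvdn_divisors // => ed e_d.
by apply: IH (dvdn_trans ed dn); rewrite ltn_neqAle e_d dvdn_leq.
Qed.

Variables p q n : nat.
Hypotheses (p_pr : prime p) (q_pr : prime q) (p_neq_q : p <> q).
Hypotheses (n_gt0 : 0 < n) (pq_n : p * q %| n).

Local Notation gT := ('Z_(p * q) * 'Z_n)%type.

Lemma pq_gt1 : 1 < p * q.
Proof. by have := prime_gt1 p_pr; have := prime_gt1 q_pr; nia. Qed.

Lemma n_gt1 : 1 < n.
Proof. exact: leq_trans pq_gt1 (dvdn_leq _ _). Qed.

(** The count of elements of order dividing n is gcd(n, pq) n = pq n, already all of G. *)
Lemma order_dvd_n (x : gT) : #[x]%g %| n.
Proof.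
have /eqP : #|[set x : gT | #[x]%g %| n]| = #|[set: gT]|.
  rewrite card_order_dvd_ZmxZn ?pq_gt1 ?n_gt1 // (gcdn_idPr pq_n) cardsT.
  by rewrite card_prod !card_ord !Zp_cast ?pq_gt1 ?n_gt1.
have := subset_leqif_cards (subsetT [set x : gT | #[x]%g %| n]) => -[_ ->].
by move/eqP/setP/(_ x); rewrite !inE.
Qed.

(** Both sides have divisor sums gcd(d, pq) d. *)
Lemma card_order_eq_ZpqxZn d : d %| n ->
  #|[set x : gT | #[x]%g == d]|
  = prime_weight p d * (prime_weight q d * totient d).
Proof.
move: d; apply: (eq_sum_divisors n_gt0) => d dn.
have d_gt0 := dvdn_gt0 n_gt0 dn.
rewrite sum_prime_weights_totient //; last exact/eqP.
rewrite -(@card_order_dvd_ZmxZn (p * q) n) ?pq_gt1 ?n_gt1 //.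
exact/esym/card_order_dvd.
Qed.

Variables (l : nat) (S : l.-tuple {group gT}).
Hypothesis (S_uniq : uniq S).
Hypothesis (S_cyclic : forall H : {group gT}, (H \in S) = cyclic H).

Lemma card_subgroup_dvd_n j : #|tnth S j| %| n.
Proof.
by have [x ->] := tnth_generator S_cyclic j; apply: order_dvd_n.
Qed.

(** Each cyclic subgroup of order e accounts for phi(e) > 0 elements of order e, so phi(e) can be
    cancelled. *)
Lemma card_cyclic_subgroups e : e %| n ->
  \sum_(j < l) (#|tnth S j| == e) = prime_weight p e * prime_weight q e.
Proof.
move=> en; have := card_order_eq_ZpqxZn en.
rewrite mulnA => h; have tot_gt0 : 0 < totient e.
  by rewrite totient_gt0 (dvdn_gt0 n_gt0).
apply/eqP; rewrite -(eqn_pmul2r tot_gt0) -h big_distrl /=.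
exact/eqP/esym/card_order_eq_sum.
Qed.

Lemma sum_cyclic_subgroups (g : nat -> nat) :
  \sum_(j < l) g #|tnth S j|
  = \sum_(e <- divisors n) prime_weight p e * prime_weight q e * g e.
Proof.
transitivity (\sum_(j < l) \sum_(e <- divisors n) (#|tnth S j| == e) * g e).
  apply: eq_bigr => j _; rewrite (bigD1_seq #|tnth S j|) ?divisors_uniq //=.
    rewrite eqxx mul1n big1 ?addn0 // => e; rewrite eq_sym => /negPf->.
    by rewrite mul0n.
  by rewrite -dvdn_divisors // card_subgroup_dvd_n.
rewrite exchange_big big_seq [RHS]big_seq; apply: eq_bigr => e /=.
by rewrite -dvdn_divisors // => en; rewrite -card_cyclic_subgroups // big_distrl.
Qed.

End OrderCounts.

Theorem theorem3p3 (p q n : nat)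
    (p_pr : prime p) (q_pr : prime q) (p_neq_q : p <> q)
    (n_gt0 : (0 < n)%N) (pq_dvd_n : (p * q %| n)%N)
    (k : nat) (d : k.-tuple nat) (r : nat -> nat)
    (d_grouped : divisors_grouped p q n d r)
    (l : nat) (S : l.-tuple {group 'Z_(p * q) * 'Z_n})
    (S_uniq : uniq S)
    (S_cyclic : forall H : {group 'Z_(p * q) * 'Z_n}, (H \in S) = cyclic H) :
  let t := partial_sum r in
  let sum_phi a b := (\sum_(a <= i < b) (totient (nth 0 d i) - 1))%N in
  let alpha :=
    (sum_phi 0 (t 1)
     + (p + 1) * sum_phi (t 1) (t 2)
     + p * sum_phi (t 2) (t 3)
     + (q + 1) * sum_phi (t 3) (t 4)
     + q * sum_phi (t 4) (t 5)
     + (p * q + p + q + 1) * sum_phi (t 5) (t 6)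
     + (p * q + p) * sum_phi (t 6) (t 7)
     + (p * q + q) * sum_phi (t 7) (t 8)
     + p * q * sum_phi (t 8) k)%N in
  l = (r 1 + (p + 1) * r 2 + p * r 3 + (q + 1) * r 4 + q * r 5
       + (p * q + p + q + 1) * r 6 + (p * q + p) * r 7 + (p * q + q) * r 8
       + p * q * (k - \sum_(1 <= j < 9) r j))%N
  /\ char_poly (adjacency_mx (power_graph ('Z_(p * q) * 'Z_n)%type))
     = (1 + 'X) ^+ alpha * char_poly (Qmx S).
Proof.
move=> t sum_phi alpha.
have sumS := sum_cyclic_subgroups p_pr q_pr p_neq_q n_gt0 pq_dvd_n S_uniq S_cyclic.
have sumD g := sum_divisors_grouped g p_pr q_pr p_neq_q d_grouped.
split.
  (* With g = 1 each range contributes its length, t (i + 1) - t i = r (i + 1). *)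
  rewrite -[LHS]card_ord -sum1_card (sumS (fun=> 1%N)) sumD !sum_nat_const_nat.
  have tS i : t i.+1 = (t i + r i.+1)%N by rewrite /t /partial_sum big_nat_recr.
  have t0 : t 0 = 0%N by rewrite /t /partial_sum big_geq.
  by rewrite -[(\sum_(1 <= j < 9) r j)%N]/(t 8) -/t !tS t0 !addKn !muln1.
have cardG : #|{: 'Z_(p * q) * 'Z_n}| = (alpha + l)%N.
  rewrite /alpha /sum_phi -(sumD (fun m => totient m - 1)%N) -sumS.
  have lE : l = (\sum_(j < l) 1)%N by rewrite sum1_card card_ord.
  rewrite [X in (_ + X)%N]lE -big_split /=.
  rewrite -sum1_card [LHS](sum_over_generators S_uniq S_cyclic (fun=> 1%N)).
  (* phi(|S_j|) >= 1, so the truncated phi - 1 loses nothing. *)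
  apply: eq_bigr => j _; rewrite muln1 subnK // totient_gt0 cardG_gt0 //.
have X1_neq0 : (1 + 'X : {poly int}) != 0.
  by rewrite addrC -(opprK 1) -polyCN polyXsubC_eq0.
apply: (mulfI (expf_neq0 l X1_neq0)).
by rewrite (char_poly_power_graph S_uniq S_cyclic) cardG exprD mulrA [_ ^+ l * _]mulrC.
Qed.
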